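(* Let $\mathcal{G}$ be a finite group, $X$ a finite $\mathcal{G}$-set, $U=\mathbb{Z}[X]$ the associated permutation $\mathcal{G}$-lattice, $\varepsilon:U\to\mathbb{Z}$ the augmentation map sending every $x\in X$ to $1$, and $A=\operatorname{Ker}\varepsilon$. Then the $\mathcal{G}$-lattice $\mathsf{Sym}^2 A$ is coflasque. If there is a $\mathcal{G}$-orbit of odd length in $X$, then $\mathsf{Sym}^2 A$ is stably permutation. Consequently, $\bigwedge^2 A\sim A^{\otimes 2}$ holds in this case.
   Context: Tensor products are over $\mathbb{Z}$. For a finite group $\mathcal{G}$, a $\mathcal{G}$-lattice is a (left) $\mathbb{Z}[\mathcal{G}]$-module that is free of finite rank over $\mathbb{Z}$. A permutation $\mathcal{G}$-lattice is a $\mathcal{G}$-lattice having a $\mathbb{Z}$-basis $X$ permuted by $\mathcal{G}$, written $\mathbb{Z}[X]$. A $\mathcal{G}$-lattice $M$ is stably permutation if $M\oplus P\cong Q$ for some permutation $\mathcal{G}$-lattices $P,Q$. It is coflasque if $H^1(\mathcal{H},M)=0$ for all subgroups $\mathcal{H}\le\mathcal{G}$. Two $\mathcal{G}$-lattices $M,N$ are equivalent, $M\sim N$, if there are exact sequences of $\mathcal{G}$-lattices $0\to M\to E\to P\to 0$ and $0\to N\to E\to Q\to 0$ (same $E$) with $P,Q$ permutation $\mathcal{G}$-lattices. For a $\mathcal{G}$-lattice $M$, $M^{\otimes 2}=M\otimes M$ with diagonal action; $\mathsf{Sym}^2M$ is the quotient of $M^{\otimes 2}$ by the subgroup generated by all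 $m\otimes m'-m'\otimes m$; $\bigwedge^2M$ is the quotient of $M^{\otimes 2}$ by the subgroup generated by all $m\otimes m$; both are $\mathcal{G}$-lattices with the induced action. *)

(* Defs.v *)
From HB Require Import structures.
From mathcomp Require Import all_boot all_order all_fingroup all_algebra.
From mathcomp Require Import generic_quotient ring_quotient boolp freeg.

Set Implicit Arguments.
Unset Strict Implicit.
Unset Printing Implicit Defensive.

Import GRing.Theory.
Local Open Scope ring_scope.
Local Open Scope quotient_scope.

(* Left actions: the library's {action gT &-> T} are right actions. *)
Definition is_laction (gT : finGroupType) (T : Type) (a : gT -> T -> T) : Prop :=
  (forall t, a 1%g t = t) /\ (forall g h t, a (g * h)%g t = a g (a h t)).

Record gset (gT : finGroupType) := GSet {
  gset_sort :> finType;
  gset_act : gT -> gset_sort -> gset_sort;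
  gset_actP : is_laction gset_act
}.

Definition gorbit (gT : finGroupType) (X : gset gT) (x : X) : {set X} :=
  [set gset_act g x | g in [set: gT]].

(* Z[G]-modules, as abelian groups with an additive left action of G. *)
Record gmodule (gT : finGroupType) := GModule {
  gmod_sort :> zmodType;
  gact : gT -> gmod_sort -> gmod_sort;
  gactP : is_laction gact;
  gact_zmod : forall g, zmod_morphism (gact g)
}.

HB.instance Definition _ (gT : finGroupType) (M : gmodule gT) (g : gT) :=
  GRing.isZmodMorphism.Build M M (@gact gT M g) (@gact_zmod gT M g).

Lemma gactB (gT : finGroupType) (M : gmodule gT) (g : gT) :
  {morph @gact gT M g : u v / u - v}.
Proof. exact: gact_zmod. Qed.

Lemma gactD (gT : finGroupType) (M : gmodule gT) (g : gT) :
  {morph @gact gT M g : u v / u + v}.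
Proof. exact: raddfD. Qed.

Section Lattices.
Variable gT : finGroupType.
Implicit Types M N E P Q : gmodule gT.

Definition is_zbasis (V : zmodType) (n : nat) (b : 'I_n -> V) : Prop :=
  forall v : V, exists! c : {ffun 'I_n -> int}, v = \sum_(i < n) b i *~ c i.

Definition is_lattice M : Prop :=
  exists (n : nat) (b : 'I_n -> M), is_zbasis b.

Definition is_permutation_lattice M : Prop :=
  exists (n : nat) (b : 'I_n -> M),
    is_zbasis b /\ forall g i, exists j, gact g (b i) = b j.

Definition is_gmorphism M N (f : M -> N) : Prop :=
  zmod_morphism f /\ forall g m, f (gact g m) = gact g (f m).

Definition gisomorphic M N : Prop :=
  exists f : M -> N, is_gmorphism f /\ bijective f.

Definition short_exact M E P (f : M -> E) (p : E -> P) : Prop :=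
  [/\ is_gmorphism f, is_gmorphism p, injective f,
      (forall e, p e = 0 <-> exists m, f m = e) &
      (forall y, exists e, p e = y)].

Definition lattice_equiv M N : Prop :=
  [/\ is_lattice M, is_lattice N &
    exists E P Q : gmodule gT,
      [/\ is_lattice E, is_permutation_lattice P, is_permutation_lattice Q,
        (exists (f : M -> E) (p : E -> P), short_exact f p) &
        (exists (f : N -> E) (q : E -> Q), short_exact f q)]].

Section DirectSum.
Variables M N : gmodule gT.

Definition dsum_act (g : gT) (u : M * N) : M * N := (gact g u.1, gact g u.2).

Fact dsum_actP : is_laction dsum_act.
Proof.
split=> [[m n]|g h [m n]]; rewrite /dsum_act /=.
  by rewrite (gactP M).1 (gactP N).1.
by rewrite (gactP M).2 (gactP N).2.
Qed.

Fact dsum_act_zmod g : zmod_morphism (dsum_act g).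
Proof. by move=> [m n] [m' n']; rewrite /dsum_act /= !raddfB. Qed.

Definition dsum : gmodule gT := GModule dsum_actP dsum_act_zmod.
End DirectSum.

Definition stably_permutation M : Prop :=
  is_lattice M /\
  exists P Q : gmodule gT,
    [/\ is_permutation_lattice P, is_permutation_lattice Q &
        gisomorphic (dsum M P) Q].

End Lattices.

Section Quotients.
Variables (V : zmodType) (S : V -> Prop).

(* The subgroup of V generated by S; being a bool-valued predicate, as the
   library's quotients require, it is the reflection of a Prop. *)
Definition zgen : {pred V} := fun v =>
  `[< forall I : {pred V}, zmod_closed I -> (forall s, S s -> s \in I) ->
      v \in I >].

Lemma zgenP v :
  reflect (forall I : {pred V}, zmod_closed I ->
             (forall s, S s -> s \in I) -> v \in I)
          (v \in zgen).
Proof. exact: asboolP. Qed.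

Lemma mem_zgen s : S s -> s \in zgen.
Proof. by move=> Ss; apply/zgenP => I _; apply. Qed.

Fact zgen_zmod_closed : zmod_closed zgen.
Proof.
split=> [|u v /zgenP Iu /zgenP Iv]; apply/zgenP=> I clI SI; first exact: clI.1.
by apply: clI.2; [apply: Iu | apply: Iv].
Qed.

HB.instance Definition _ := GRing.isZmodClosed.Build V zgen zgen_zmod_closed.

Definition zquot : zmodType := Quotient.quot zgen.
Definition zpi (v : V) : zquot := \pi v.

Lemma zpi_zmod : zmod_morphism zpi.
Proof. exact: (raddfB (\pi_(Quotient.quot zgen))). Qed.

Lemma zpiP u v : zpi u = zpi v <-> u - v \in zgen.
Proof. by rewrite Quotient.idealrBE; split=> [uv|/eqP //]; apply/eqP. Qed.

Lemma zpi_surj w : exists v, zpi v = w.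
Proof. by exists (repr w); rewrite /zpi reprK. Qed.

End Quotients.

Section QuotientModule.
Variables (gT : finGroupType) (V : gmodule gT) (S : V -> Prop).
Hypothesis S_stable : forall g s, S s -> S (gact g s).

Definition quot_act (g : gT) (w : zquot S) : zquot S :=
  zpi S (gact g (repr w)).

Fact quot_act_pi g v : quot_act g (zpi S v) = zpi S (gact g v).
Proof.
apply/zpiP; rewrite -raddfB /=.
have /zpiP/zgenP gen_rv : zpi S (repr (zpi S v)) = zpi S v.
  by rewrite {1}/zpi reprK.
pose I : {pred V} := fun u => gact g u \in zgen S.
apply: (gen_rv I) => [|s Ss]; last exact/mem_zgen/S_stable.
by split=> [|u u' Iu Iu']; rewrite /in_mem/= /I ?raddf0 ?raddfB ?rpred0 ?rpredB.
Qed.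

Fact quot_actP : is_laction quot_act.
Proof.
split=> [w|g h w]; have [v <-] := zpi_surj w; rewrite !quot_act_pi.
  by rewrite (gactP V).1.
by rewrite (gactP V).2.
Qed.

Fact quot_act_zmod g : zmod_morphism (quot_act g).
Proof.
move=> w w'; have [v <-] := zpi_surj w; have [v' <-] := zpi_surj w'.
by rewrite -zpi_zmod !quot_act_pi raddfB zpi_zmod.
Qed.

Definition gquot : gmodule gT := GModule quot_actP quot_act_zmod.
End QuotientModule.

Section Cohomology.
Variables (gT : finGroupType) (H : {group gT}) (M : gmodule gT).

(* H^1(H, M) as crossed homomorphisms modulo principal ones. *)
Definition cocycle1 : {pred {ffun subg_of H -> M}} := fun f =>
  `[< forall g h, f (g * h)%g = f g + gact (sgval g) (f h) >].

Fact cocycle1_zmod_closed : zmod_closed cocycle1.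
Proof.
split=> [|f f' /asboolP Zf /asboolP Zf']; apply/asboolP=> g h.
  by rewrite !ffunE raddf0 addr0.
by rewrite !ffunE Zf Zf' raddfB opprD addrACA.
Qed.

HB.instance Definition _ :=
  GRing.isZmodClosed.Build _ cocycle1 cocycle1_zmod_closed.

Record Z1 := MkZ1 { Z1_val :> {ffun subg_of H -> M}; _ : Z1_val \in cocycle1 }.
HB.instance Definition _ := [isSub for Z1_val].
HB.instance Definition _ := [Choice of Z1 by <:].
HB.instance Definition _ := [SubChoice_isSubZmodule of Z1 by <:].

Definition coboundary1 (f : Z1) : Prop :=
  exists m : M, forall g, Z1_val f g = gact (sgval g) m - m.

Definition H1 : zmodType := zquot coboundary1.

End Cohomology.

Definition coflasque (gT : finGroupType) (M : gmodule gT) : Prop :=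
  is_lattice M /\ forall (H : {group gT}) (c : H1 H M), c = 0.

Section Tensor.
Variables (gT : finGroupType) (M N : gmodule gT).

Definition fgen (u : M * N) : {freeg (M * N) / int} := Freeg [:: (1, u)].

Definition free_act (g : gT) : {freeg (M * N) / int} -> {freeg (M * N) / int} :=
  fglift (fun u => fgen (gact g u.1, gact g u.2)).

Fact free_act_zmod g : zmod_morphism (free_act g).
Proof. exact: lift_is_additive. Qed.

HB.instance Definition _ g :=
  GRing.isZmodMorphism.Build _ _ (free_act g) (free_act_zmod g).

Lemma free_act_gen g u : free_act g (fgen u) = fgen (gact g u.1, gact g u.2).
Proof. by rewrite /free_act /fgen liftU scale1r. Qed.

Lemma free_ext (W : zmodType) (f f' : {additive {freeg (M * N) / int} -> W}) :
  (forall u, f (fgen u) = f' (fgen u)) -> f =1 f'.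
Proof.
move=> eq_ff' D; rewrite -[D]freeg_sumE !raddf_sum; apply: eq_bigr => u _.
have ->: Freeg [:: (coeff u D, u)] = fgen u *~ coeff u D.
  by rewrite /fgen freegU_mulz intz.
by rewrite !raddfMz eq_ff'.
Qed.

Fact free_actP : is_laction free_act.
Proof.
split=> [D|g h D].
  apply: (free_ext (f := free_act 1%g) (f' := idfun)) => -[m n].
  by rewrite /= free_act_gen (gactP M).1 (gactP N).1.
apply: (free_ext (f := free_act (g * h)%g)
                 (f' := free_act g \o free_act h)) => -[m n] /=.
by rewrite !free_act_gen /= (gactP M).2 (gactP N).2.
Qed.

Definition free_pairs : gmodule gT := GModule free_actP free_act_zmod.

Inductive bilinear_relation : free_pairs -> Prop :=
| BilinearL m m' n :
    bilinear_relation (fgen (m + m', n) - fgen (m, n) - fgen (m', n))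
| BilinearR m n n' :
    bilinear_relation (fgen (m, n + n') - fgen (m, n) - fgen (m, n')).

Fact bilinear_relation_stable g s :
  bilinear_relation s -> bilinear_relation (gact g s).
Proof.
have actE u : gact g (fgen u : free_pairs) = fgen (gact g u.1, gact g u.2).
  exact: free_act_gen.
case=> *; rewrite 2!gactB !actE /= gactD.
  exact: BilinearL.
exact: BilinearR.
Qed.

(* The tensor product over Z with the diagonal action, as the free abelian
   group on M x N modulo the biadditivity relations. *)
Definition tensor : gmodule gT := gquot bilinear_relation_stable.

Definition tens (m : M) (n : N) : tensor := zpi bilinear_relation (fgen (m, n)).

Lemma tens_act g m n : gact g (tens m n) = tens (gact g m) (gact g n).
Proof.
rewrite /tens /= quot_act_pi; last exact: bilinear_relation_stable.
by rewrite /= free_act_gen.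
Qed.

End Tensor.

Section Squares.
Variables (gT : finGroupType) (M : gmodule gT).

Definition sym2_relation (t : tensor M M) : Prop :=
  exists m m' : M, t = tens m m' - tens m' m.

Fact sym2_relation_stable g t : sym2_relation t -> sym2_relation (gact g t).
Proof.
by case=> m [m' ->]; exists (gact g m), (gact g m'); rewrite gactB !tens_act.
Qed.

Definition Sym2 : gmodule gT := gquot sym2_relation_stable.

Definition ext2_relation (t : tensor M M) : Prop :=
  exists m : M, t = tens m m.

Fact ext2_relation_stable g t : ext2_relation t -> ext2_relation (gact g t).
Proof. by case=> m ->; exists (gact g m); rewrite tens_act. Qed.

Definition Ext2 : gmodule gT := gquot ext2_relation_stable.

End Squares.

Section Augmentation.
Variables (gT : finGroupType) (X : gset gT).

(* Z[X] as integer-valued functions on X; g maps the basis element x, i.e.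
   the indicator function of x, to the basis element g x. *)
Definition perm_act (g : gT) (u : {ffun X -> int}) : {ffun X -> int} :=
  [ffun x => u (gset_act g^-1%g x)].

Fact perm_actP : is_laction perm_act.
Proof.
split=> [u|g h u]; apply/ffunP=> x; rewrite !ffunE.
  by rewrite invg1 (gset_actP X).1.
by rewrite invMg (gset_actP X).2.
Qed.

Fact perm_act_zmod g : zmod_morphism (perm_act g).
Proof. by move=> u v; apply/ffunP=> x; rewrite !ffunE. Qed.

Definition perm_lattice : gmodule gT := GModule perm_actP perm_act_zmod.

Definition perm_basis (x : X) : perm_lattice := [ffun y => (y == x)%:R : int].

Lemma perm_basis_act g x :
  gact g (perm_basis x) = perm_basis (gset_act g x).
Proof.
apply/ffunP=> y; rewrite !ffunE; congr (_%:R); congr nat_of_bool.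
apply/eqP/eqP=> [<-|->]; rewrite -(gset_actP X).2.
  by rewrite mulgV (gset_actP X).1.
by rewrite mulVg (gset_actP X).1.
Qed.

Definition augmentation (u : perm_lattice) : int := \sum_(x : X) u x.

Fact augmentation_zmod : zmod_morphism augmentation.
Proof. by move=> u v; rewrite -sumrB; apply: eq_bigr=> x _; rewrite !ffunE. Qed.

HB.instance Definition _ :=
  GRing.isZmodMorphism.Build _ _ augmentation augmentation_zmod.

Lemma augmentation_basis x : augmentation (perm_basis x) = 1.
Proof.
rewrite /augmentation (bigD1 x) //= big1 => [|y /negPf yx].
  by rewrite ffunE eqxx addr0.
by rewrite ffunE yx.
Qed.

Lemma augmentation_act g u : augmentation (gact g u) = augmentation u.
Proof.
rewrite /augmentation (reindex_inj (h := gset_act g)) => [|x y exy].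
  apply: eq_bigr=> x _; rewrite ffunE -(gset_actP X).2 mulVg.
  by rewrite (gset_actP X).1.
by rewrite -[x](gset_actP X).1 -[y](gset_actP X).1 -(mulVg g)
           !(gset_actP X).2 exy.
Qed.

Definition aug_ker : {pred perm_lattice} := fun u => augmentation u == 0.

Fact aug_ker_zmod_closed : zmod_closed aug_ker.
Proof.
split=> [|u v /eqP eu /eqP ev]; apply/eqP; first exact: raddf0.
by rewrite augmentation_zmod eu ev subrr.
Qed.

HB.instance Definition _ :=
  GRing.isZmodClosed.Build _ aug_ker aug_ker_zmod_closed.

Record aug_sort := MkAug { aug_val :> perm_lattice; _ : aug_val \in aug_ker }.
HB.instance Definition _ := [isSub for aug_val].
HB.instance Definition _ := [Choice of aug_sort by <:].
HB.instance Definition _ := [SubChoice_isSubZmodule of aug_sort by <:].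

Fact aug_act_mem g (a : aug_sort) : gact g (aug_val a) \in aug_ker.
Proof. by rewrite [_ \in _]/(_ == _) augmentation_act; exact: (valP a). Qed.

Definition aug_act (g : gT) (a : aug_sort) : aug_sort := MkAug (aug_act_mem g a).

Fact aug_actP : is_laction aug_act.
Proof.
split=> [a|g h a]; apply: val_inj.
  exact: (gactP perm_lattice).1.
exact: (gactP perm_lattice).2.
Qed.

Fact aug_act_zmod g : zmod_morphism (aug_act g).
Proof. by move=> a b; apply: val_inj; exact: (@gactB _ perm_lattice g). Qed.

Definition aug_lattice : gmodule gT := GModule aug_actP aug_act_zmod.

End Augmentation.

(* Main.v *)
From HB Require Import structures.
From mathcomp Require Import all_boot all_order all_fingroup all_algebra.
From mathcomp Require Import generic_quotient boolp freeg ring lra.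
Require Import Defs.

(** Write U for Z[X] and eps for the augmentation, so that A = Ker eps, and
    write products in symmetric squares as u v.  Everything rests on the
    additive equivariant map

      contract : Sym2 U -> U,   u v |-> eps(u) v + eps(v) u,

    whose kernel is exactly Sym2 A ([aug_incl2_inj], [contract_kernel]).  Indeed
    a point t of X gives an additive, not equivariant, projection p of U onto A
    with u = p u + eps(u) t, and expanding a product along it gives
    w = Sym2(p) w + (contract w) t - eps2(w) t^2, where eps2 (u v) = eps(u) eps(v)
    satisfies eps(contract w) = 2 eps2(w).  As Sym2 U is again a permutation
    lattice, with basis the monomials in X, it has no first cohomology
    ([permutation_crossed_hom]), and the two assertions on Sym2 A become
    questions about lifting along contract.

    Coflasqueness.  A crossed homomorphism of H into Sym2 A becomes g w - w in
    Sym2 U.  Then contract w is fixed by H and eps (contract w) is even, and it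
    suffices to lift contract w to an H-fixed element of Sym2 U, since the
    difference of w and that lift lies in Sym2 A.  The lift is given by a
    formula ([invariant_lift]).  Let q : U -> Sym2 U be the additive map with
    q x = x^2 for x in X, so contract (q u) = 2 u; the element u^2 - q u is
    divisible by 2, and v = (u^2 - q u) / 2 has contract v = (eps(u) - 1) u.
    Hence u = contract (q (k u) - v) if eps(u) = 2 k, and torsion-freeness shows
    that q (k u) - v is fixed by whatever fixes u.

    Stable permutation.  The image of contract consists of the u with eps(u)
    even; it is not a permutation lattice in general, but becomes one after
    adding Z when there is an invariant u0 with eps(u0) odd, such as the sum of
    an orbit of odd length.  Composing the isomorphisms makes an exact sequence
    0 -> Sym2 A -> Sym2 U + Z -> U + Z -> 0 that has an explicit equivariant
    section, whence Sym2 A + (U + Z) is isomorphic to Sym2 U + Z.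

    Equivalence.  For every lattice M the map m /\ m' |-> m (x) m' - m' (x) m
    embeds Ext2 M in M (x) M with quotient Sym2 M.  If Sym2 M + P = Q with P and Q
    permutation lattices, then E = (M (x) M) + P contains Ext2 M with quotient Q,
    and M (x) M with quotient P ([ext2_equiv_tensor]). *)

Set Implicit Arguments.
Unset Strict Implicit.
Unset Printing Implicit Defensive.

Import GRing.Theory Num.Theory.
Local Open Scope ring_scope.

Arguments gact : simpl never.

(** * Additive and biadditive maps *)

Lemma additive_zmod (V W : zmodType) (f : V -> W) :
  {morph f : x y / x + y} -> zmod_morphism f.
Proof. by move=> fD x y; apply: (addIr (f y)); rewrite -fD !subrK. Qed.

Lemma zmod_additive (V W : zmodType) (f : V -> W) :
  zmod_morphism f -> {morph f : x y / x + y}.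
Proof.
move=> fB; pose f' : {additive V -> W} :=
  HB.pack f (GRing.isZmodMorphism.Build V W f fB).
exact: (raddfD f').
Qed.

Lemma zmod0 (V W : zmodType) (f : V -> W) : zmod_morphism f -> f 0 = 0.
Proof. by move=> fB; rewrite -(subrr 0) fB subrr. Qed.

Lemma zmod_opp (V W : zmodType) (f : V -> W) : zmod_morphism f -> {morph f : x / - x}.
Proof. by move=> fB x; rewrite -sub0r fB (zmod0 fB) sub0r. Qed.

Definition biadditive (U V W : zmodType) (beta : U -> V -> W) : Prop :=
  (forall v, zmod_morphism (beta^~ v)) /\ (forall u, zmod_morphism (beta u)).

Section Biadditive.
Variables (U V W : zmodType) (beta : U -> V -> W) (bi : biadditive beta).

Lemma biadd_sumr I (r : seq I) (P : pred I) (F : I -> V) (c : I -> int) u :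
  beta u (\sum_(i <- r | P i) F i *~ c i) = \sum_(i <- r | P i) beta u (F i) *~ c i.
Proof.
pose f : {additive V -> W} :=
  HB.pack (beta u) (GRing.isZmodMorphism.Build V W (beta u) (bi.2 u)).
by rewrite -[beta u]/(f : V -> W) raddf_sum; apply: eq_bigr => i _; rewrite raddfMz.
Qed.

Lemma biadd_suml I (r : seq I) (P : pred I) (F : I -> U) (c : I -> int) v :
  beta (\sum_(i <- r | P i) F i *~ c i) v = \sum_(i <- r | P i) beta (F i) v *~ c i.
Proof.
pose f : {additive U -> W} :=
  HB.pack (beta^~ v) (GRing.isZmodMorphism.Build U W (beta^~ v) (bi.1 v)).
rewrite -[LHS]/(f (\sum_(i <- r | P i) F i *~ c i)) raddf_sum.
by apply: eq_bigr => i _; rewrite raddfMz.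
Qed.

Lemma biadd_mulzr u v k : beta u (v *~ k) = beta u v *~ k.
Proof.
have := biadd_sumr [:: tt] predT (fun _ => v) (fun _ => k) u.
by rewrite !big_seq1.
Qed.

Lemma biadd_mulzl u v k : beta (u *~ k) v = beta u v *~ k.
Proof.
have := biadd_suml [:: tt] predT (fun _ => u) (fun _ => k) v.
by rewrite !big_seq1.
Qed.

End Biadditive.

Lemma biadditive_comp (U U' V V' W W' : zmodType) (f : {additive U' -> U})
    (g : {additive V' -> V}) (h : {additive W -> W'}) (beta : U -> V -> W) :
  biadditive beta -> biadditive (fun u v => h (beta (f u) (g v))).
Proof.
move=> bi; split=> [v x y|u x y]; rewrite raddfB.
  by rewrite (bi.1 (g v)) raddfB.
by rewrite (bi.2 (f u)) raddfB.
Qed.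

(** * Universal properties of the tensor, symmetric and exterior squares *)

HB.instance Definition _ (V : zmodType) (S : V -> Prop) :=
  GRing.isZmodMorphism.Build V (zquot S) (zpi S) (@zpi_zmod V S).

Lemma zpi_gen (V : zmodType) (S : V -> Prop) s : S s -> zpi S s = 0.
Proof.
by move=> Ss; rewrite -(raddf0 (zpi S)); apply/zpiP; rewrite subr0; apply: mem_zgen.
Qed.

Section QuotientLift.
Variables (V W : zmodType) (S : V -> Prop) (f : {additive V -> W}).
Hypothesis f_S : forall s, S s -> f s = 0.

Lemma zgen_ker v : v \in zgen S -> f v = 0.
Proof.
pose I : {pred V} := fun u => f u == 0.
move=> /zgenP genv; apply/eqP; apply: (genv I) => [|s Ss].
  split=> [|u u' /eqP fu /eqP fu']; first by rewrite unfold_in /I raddf0.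
  by rewrite unfold_in /I raddfB fu fu' subrr.
by rewrite unfold_in /I f_S.
Qed.

(** The lifts below are stated as existence of an additive map, and then chosen,
    so that their additivity comes packed with them. *)
Fact zquot_lift_subproof : exists h : {additive zquot S -> W},
  forall v, h (zpi S v) = f v.
Proof.
pose h (w : zquot S) : W := f (generic_quotient.repr w).
have hE v : h (zpi S v) = f v.
  apply/eqP; rewrite -subr_eq0 -raddfB /=; apply/eqP/zgen_ker/zpiP.
  by rewrite {1}/zpi reprK.
have h_zmod : zmod_morphism h.
  move=> x y; have [u <-] := zpi_surj x; have [v <-] := zpi_surj y.
  by rewrite -zpi_zmod !hE raddfB.
pose h' : {additive zquot S -> W} :=
  HB.pack h (GRing.isZmodMorphism.Build _ _ h h_zmod).
by exists h'.
Qed.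

Definition zquot_lift : {additive zquot S -> W} := sval (cid zquot_lift_subproof).

Lemma zquot_liftE v : zquot_lift (zpi S v) = f v.
Proof. exact: (svalP (cid zquot_lift_subproof)). Qed.

End QuotientLift.

Section TensorLift.
Variables (gT : finGroupType) (M N : gmodule gT).

Lemma tens_biadditive : biadditive (@tens gT M N).
Proof.
split=> [n|m]; apply: additive_zmod => x y.
  have := zpi_gen (BilinearL x y n).
  by rewrite 2!zpi_zmod => /eqP; rewrite -addrA -opprD subr_eq0 => /eqP.
have := zpi_gen (BilinearR m x y).
by rewrite 2!zpi_zmod => /eqP; rewrite -addrA -opprD subr_eq0 => /eqP.
Qed.

Lemma tensor_ext (W : zmodType) (f f' : {additive tensor M N -> W}) :
  (forall m n, f (tens m n) = f' (tens m n)) -> f =1 f'.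
Proof.
move=> eq_f w; have [v <-] := zpi_surj w.
pose p : {additive {freeg (M * N) / int} -> tensor M N} :=
  zpi (@bilinear_relation gT M N).
by apply: (@free_ext _ _ _ _ (f \o p) (f' \o p)) => -[m n]; apply: eq_f.
Qed.

Variables (W : zmodType) (beta : M -> N -> W) (bi : biadditive beta).

Fact tensor_lift_subproof : exists h : {additive tensor M N -> W},
  forall m n, h (tens m n) = beta m n.
Proof.
pose f0 : {freeg (M * N) / int} -> zmodule W :=
    fglift (fun u => beta u.1 u.2 : zmodule W).
have f0_zmod : zmod_morphism (f0 : {freeg (M * N) / int} -> W).
  have fB := @lift_is_additive _ _ _ (fun u : M * N => beta u.1 u.2 : zmodule W).
  exact: fB.
pose f : {additive {freeg (M * N) / int} -> W} :=
  HB.pack (f0 : {freeg (M * N) / int} -> W)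
    (GRing.isZmodMorphism.Build _ _ _ f0_zmod).
have fE u : f (fgen u) = beta u.1 u.2.
  by rewrite /= /f0 /fgen liftU scale1r.
have f_rel s : bilinear_relation s -> f s = 0.
  by case=> *; rewrite !raddfB !fE /=
    ?(zmod_additive (bi.1 _)) ?(zmod_additive (bi.2 _)) -addrA -opprD subrr.
by exists (zquot_lift f_rel) => m n; rewrite /tens zquot_liftE fE.
Qed.

Definition tensor_lift : {additive tensor M N -> W} :=
  sval (cid tensor_lift_subproof).

Lemma tensor_liftE m n : tensor_lift (tens m n) = beta m n.
Proof. exact: (svalP (cid tensor_lift_subproof)). Qed.

End TensorLift.

Section SymmetricSquare.
Variables (gT : finGroupType) (M : gmodule gT).

Definition to_sym2 (t : tensor M M) : Sym2 M := zpi (@sym2_relation gT M) t.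

Definition smul (m m' : M) : Sym2 M := to_sym2 (tens m m').

HB.instance Definition _ := GRing.isZmodMorphism.Build (tensor M M) (Sym2 M)
  to_sym2 (@zpi_zmod _ (@sym2_relation gT M)).

Lemma to_sym2_surj w : exists t, to_sym2 t = w.
Proof. exact: zpi_surj. Qed.

Lemma to_sym2_act g t : to_sym2 (gact g t) = gact g (to_sym2 t).
Proof. by apply/esym/quot_act_pi; apply: sym2_relation_stable. Qed.

(** Phrased as membership in every subgroup I that contains the relations: with I
    the image of a map this bounds the kernel by that image. *)
Lemma to_sym2_kernel (I : {pred tensor M M}) t :
  zmod_closed I -> (forall m m', tens m m' - tens m' m \in I) ->
  to_sym2 t = 0 -> t \in I.
Proof.
move=> clI relI t0; rewrite -[t]subr0.
have /zpiP/zgenP genI : zpi (@sym2_relation gT M) t = zpi (@sym2_relation gT M) 0.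
  by rewrite [LHS]t0 raddf0.
by apply: genI => // s [m [m' ->]].
Qed.

Lemma smulC m m' : smul m m' = smul m' m.
Proof. by apply/zpiP/mem_zgen; exists m, m'. Qed.

Lemma smul_biadditive : biadditive smul.
Proof.
exact: (@biadditive_comp _ _ _ _ _ _ idfun idfun to_sym2 _ (tens_biadditive M M)).
Qed.

Lemma smul_act g m m' : gact g (smul m m') = smul (gact g m) (gact g m').
Proof. by rewrite /smul -to_sym2_act tens_act. Qed.

Lemma sym2_ext (W : zmodType) (f f' : {additive Sym2 M -> W}) :
  (forall m m', f (smul m m') = f' (smul m m')) -> f =1 f'.
Proof.
move=> eq_f w; have [t <-] := zpi_surj w.
exact: (@tensor_ext _ _ _ _ (f \o to_sym2) (f' \o to_sym2) eq_f).
Qed.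

Section Lift.
Variables (W : zmodType) (beta : M -> M -> W).
Hypotheses (bi : biadditive beta) (betaC : forall m m', beta m m' = beta m' m).

Lemma tensor_lift_sym s : sym2_relation s -> tensor_lift bi s = 0.
Proof.
by case=> m [m' ->]; rewrite raddfB !tensor_liftE betaC subrr.
Qed.

Definition sym2_lift : {additive Sym2 M -> W} := zquot_lift tensor_lift_sym.

Lemma sym2_liftE m m' : sym2_lift (smul m m') = beta m m'.
Proof. by rewrite /sym2_lift /smul zquot_liftE tensor_liftE. Qed.
End Lift.

End SymmetricSquare.

Section ExteriorSquare.
Variables (gT : finGroupType) (M : gmodule gT).

Definition wedge (m m' : M) : Ext2 M := zpi (@ext2_relation gT M) (tens m m').

Lemma wedge_biadditive : biadditive wedge.
Proof.
exact: (@biadditive_comp _ _ _ _ _ _ idfun idfun (zpi (@ext2_relation gT M)) _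
          (tens_biadditive M M)).
Qed.

Lemma wedgeid m : wedge m m = 0.
Proof. by apply: (@zpi_gen (tensor M M)); exists m. Qed.

Lemma wedge_act g m m' : gact g (wedge m m') = wedge (gact g m) (gact g m').
Proof.
by rewrite /wedge -tens_act; apply: quot_act_pi; apply: ext2_relation_stable.
Qed.

Lemma ext2_ext (W : zmodType) (f f' : {additive Ext2 M -> W}) :
  (forall m m', f (wedge m m') = f' (wedge m m')) -> f =1 f'.
Proof.
move=> eq_f w; have [t <-] := zpi_surj w.
pose p : {additive tensor M M -> Ext2 M} := zpi (@ext2_relation gT M).
exact: (@tensor_ext _ _ _ _ (f \o p) (f' \o p) eq_f).
Qed.

Section Lift.
Variables (W : zmodType) (beta : M -> M -> W).
Hypotheses (bi : biadditive beta) (beta_alt : forall m, beta m m = 0).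

Lemma tensor_lift_alt s : ext2_relation s -> tensor_lift bi s = 0.
Proof. by case=> m ->; rewrite tensor_liftE. Qed.

Definition ext2_lift : {additive Ext2 M -> W} := zquot_lift tensor_lift_alt.

Lemma ext2_liftE m m' : ext2_lift (wedge m m') = beta m m'.
Proof. by rewrite /ext2_lift /wedge zquot_liftE tensor_liftE. Qed.
End Lift.

End ExteriorSquare.

Section SymmetricSquareMap.
Variables (gT : finGroupType) (M N : gmodule gT) (f : {additive M -> N}).

Definition sym2_map : {additive Sym2 M -> Sym2 N} :=
  sym2_lift (biadditive_comp f f idfun (smul_biadditive N))
            (fun m m' => smulC (f m) (f m')).

Lemma sym2_mapE m m' : sym2_map (smul m m') = smul (f m) (f m').
Proof. exact: sym2_liftE. Qed.

Lemma sym2_map_act g w :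
  (forall g m, f (gact g m) = gact g (f m)) ->
  sym2_map (gact g w) = gact g (sym2_map w).
Proof.
move=> fG; apply: (@sym2_ext _ _ _ (sym2_map \o gact g) (gact g \o sym2_map)).
by move=> m m' /=; rewrite smul_act !sym2_mapE smul_act !fG.
Qed.

End SymmetricSquareMap.

(* From here on only the universal properties of these quotients matter. *)
Opaque tensor Sym2 Ext2.

(** * Dual bases *)

Section DualBasis.
Variables (V : zmodType) (I : finType) (J : pred I) (b : I -> V).
Variable c : I -> {additive V -> int}.

Definition dual_sum (v : V) : V := \sum_(i | J i) b i *~ c i v.

Fact dual_sum_zmod : zmod_morphism dual_sum.
Proof.
move=> u v; rewrite /dual_sum -sumrB; apply: eq_bigr => i _.
by rewrite raddfB mulrzBr.
Qed.

HB.instance Definition _ := GRing.isZmodMorphism.Build V V dual_sum dual_sum_zmod.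

(** Coordinate maps given along with the basis turn the verification of a basis
    into an identity of additive maps, which an extensionality principle checks on
    generators, and an orthogonality relation.  The predicate J selects the basis
    within a larger index type: in a square the basis is a triangle of the pairs. *)
Definition dual_basis : Prop :=
  (forall v, v = dual_sum v) /\
  (forall i j, J i -> J j -> c i (b j) = (i == j)%:R).

Hypothesis bc : dual_basis.

Lemma dual_basis_coef (a : I -> int) i :
  J i -> c i (\sum_(j | J j) b j *~ a j) = a i.
Proof.
move=> Ji; rewrite raddf_sum (bigD1 i) //= big1 => [|j /andP[Jj ji]].
  by rewrite addr0 raddfMz bc.2 // eqxx -mulrzl mulr1 intz.
by rewrite raddfMz bc.2 // eq_sym (negPf ji) mul0rz.
Qed.

Lemma dual_basis_inj i j : J i -> J j -> b i = b j -> i = j.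
Proof.
move=> Ji Jj eq_b; have := bc.2 _ _ Ji Jj.
by rewrite -eq_b bc.2 // eqxx; case: eqP.
Qed.

Lemma dual_basis_torsion_free (v : V) : v *+ 2 = 0 -> v = 0.
Proof.
move=> v2; rewrite (bc.1 v) /dual_sum big1 // => i _.
have /eqP : c i (v *+ 2) = 0 by rewrite v2 raddf0.
by rewrite raddfMn mulrn_eq0 /= => /eqP ->.
Qed.

End DualBasis.

Lemma dual_basis_enum (V : zmodType) (I : finType) (J : pred I) (b : I -> V)
    (c : I -> {additive V -> int}) :
  dual_basis J b c ->
  dual_basis predT (fun k : 'I_#|J| => b (enum_val k)) (fun k => c (enum_val k)).
Proof.
move=> bc; split=> [v|k l _ _].
  by rewrite {1}(bc.1 v) /dual_sum -(big_enum_val (fun i => b i *~ c i v)).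
by rewrite bc.2 ?(inj_eq enum_val_inj) //; apply: enum_valP.
Qed.

Lemma dual_basis_zbasis (V : zmodType) n (b : 'I_n -> V) c :
  dual_basis predT b c -> is_zbasis b.
Proof.
move=> bc v; exists [ffun i => c i v]; split.
  by under eq_bigr do rewrite ffunE; apply: bc.1.
by move=> a ->; apply/ffunP => i; rewrite ffunE (dual_basis_coef bc).
Qed.

(** Uniqueness of the coordinates is what makes them additive. *)
Lemma zbasis_dual_basis (V : zmodType) n (b : 'I_n -> V) :
  is_zbasis b -> exists c, dual_basis predT b c.
Proof.
move=> zb.
have [a aE] : exists a : V -> {ffun 'I_n -> int},
    forall v, v = \sum_(i < n) b i *~ a v i.
  exists (fun v => sval (cid (zb v))) => v.
  by case: (cid (zb v)) => ? [].
have a_uniq v (c : {ffun 'I_n -> int}) : v = \sum_(i < n) b i *~ c i -> a v = c.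
  by case: (zb v) => c0 [_ uniq_c] Ec; rewrite -(uniq_c _ (aE v)) -(uniq_c _ Ec).
have a_zmod : zmod_morphism a.
  move=> u v; apply: a_uniq; rewrite {1}(aE u) {1}(aE v) -sumrB.
  by apply: eq_bigr => i _; rewrite !ffunE mulrzBr.
have ai_zmod i : zmod_morphism (fun v => a v i).
  by move=> u v; rewrite a_zmod !ffunE.
pose c i : {additive V -> int} :=
  HB.pack (fun v => a v i) (GRing.isZmodMorphism.Build V int _ (ai_zmod i)).
exists c; split=> [v|i j _ _]; first exact: aE.
rewrite /= (a_uniq _ [ffun k => (k == j)%:R]) ?ffunE // (bigD1 j) //=.
rewrite ffunE eqxx mulr1z big1 ?addr0 // => k /negPf kj.
by rewrite ffunE kj mulr0z.
Qed.

Section Lattices.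
Variables (gT : finGroupType) (M : gmodule gT).
Variables (I : finType) (J : pred I) (b : I -> M) (c : I -> {additive M -> int}).
Hypothesis bc : dual_basis J b c.

Lemma dual_basis_lattice : is_lattice M.
Proof.
by eexists; eexists; apply: dual_basis_zbasis (dual_basis_enum bc).
Qed.

Lemma dual_basis_permutation :
    (forall g i, J i -> exists2 j, J j & gact g (b i) = b j) ->
  is_permutation_lattice M.
Proof.
move=> bJ; eexists; eexists; split.
  exact: dual_basis_zbasis (dual_basis_enum bc).
move=> g k; have [j Jj ->] := bJ g _ (enum_valP k).
by exists (enum_rank_in Jj j); rewrite enum_rankK_in.
Qed.

End Lattices.

Lemma permutation_lattice_lattice (gT : finGroupType) (M : gmodule gT) :
  is_permutation_lattice M -> is_lattice M.
Proof. by case=> n [b [zb _]]; exists n, b. Qed.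

Lemma dsum_actE (gT : finGroupType) (M N : gmodule gT) g (u : dsum M N) :
  gact g u = (gact g u.1, gact g u.2).
Proof. by []. Qed.

Lemma dsum_pair_zmod (gT : finGroupType) (V : zmodType) (M N : gmodule gT)
    (f : V -> M) (g : V -> N) :
  zmod_morphism f -> zmod_morphism g ->
  zmod_morphism (fun v => (f v, g v) : dsum M N).
Proof. by move=> fB gB x y; rewrite fB gB. Qed.

Section DualBasisSum.
Variables (gT : finGroupType) (M N : gmodule gT) (m n : nat).
Variables (b : 'I_m -> M) (c : 'I_m -> {additive M -> int}).
Variables (d : 'I_n -> N) (e : 'I_n -> {additive N -> int}).
Hypotheses (bc : dual_basis predT b c) (de : dual_basis predT d e).

Definition dsum_basis (i : 'I_m + 'I_n) : dsum M N :=
  match i with inl i => (b i, 0) | inr j => (0, d j) end.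

Definition dsum_coef (i : 'I_m + 'I_n) : {additive dsum M N -> int} :=
  match i with inl i => (c i \o fst)%FUN | inr j => (e j \o snd)%FUN end.

Lemma dsum_dual_basis : dual_basis predT dsum_basis dsum_coef.
Proof.
split=> [[u v]|[i|i] [j|j] _ _] /=; last 1 first.
- exact: de.2.
- rewrite [RHS]surjective_pairing /dual_sum; congr pair.
    rewrite (raddf_sum fst) big_sumType /= [X in _ + X]big1 => [|i _].
      rewrite addr0 {1}(bc.1 u); apply: eq_bigr => i _; by rewrite (raddfMz fst).
    by rewrite (raddfMz fst) mul0rz.
  rewrite (raddf_sum snd) big_sumType /= [X in X + _]big1 => [|i _].
    rewrite add0r {1}(de.1 v); apply: eq_bigr => i _; by rewrite (raddfMz snd).
  by rewrite (raddfMz snd) mul0rz.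
- exact: bc.2.
- exact: raddf0.
- exact: raddf0.
Qed.
End DualBasisSum.

Lemma dsum_lattice (gT : finGroupType) (M N : gmodule gT) :
  is_lattice M -> is_lattice N -> is_lattice (dsum M N).
Proof.
case=> [m [b /zbasis_dual_basis [c bc]]] [n [d /zbasis_dual_basis [e de]]].
exact: dual_basis_lattice (dsum_dual_basis bc de).
Qed.

Lemma dsum_permutation (gT : finGroupType) (M N : gmodule gT) :
  is_permutation_lattice M -> is_permutation_lattice N ->
  is_permutation_lattice (dsum M N).
Proof.
case=> [m [b [/zbasis_dual_basis [c bc] bG]]].
case=> [n [d [/zbasis_dual_basis [e de] dG]]].
apply: dual_basis_permutation (dsum_dual_basis bc de) _ => g [i|j] _ /=.
  have [i' ei'] := bG g i; exists (inl i') => //.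
  by rewrite dsum_actE /= ei' raddf0.
have [j' ej'] := dG g j; exists (inr j') => //.
by rewrite dsum_actE /= ej' raddf0.
Qed.

Section TriangularSums.
Variables (V : zmodType) (n : nat) (F : 'I_n * 'I_n -> V).

Lemma sum_pair_le :
  \sum_(p : 'I_n * 'I_n | (p.1 <= p.2)%N) F p =
    \sum_i F (i, i) + \sum_(p : 'I_n * 'I_n | (p.1 < p.2)%N) F p.
Proof.
rewrite (bigID (fun p => p.1 == p.2)) /=; congr (_ + _); last first.
  by apply: eq_bigl => p; rewrite ltn_neqAle andbC.
rewrite (reindex_onto (fun i => (i, i)) fst) => [|[i j] /andP[_ /= /eqP->]] //=.
by apply: eq_bigl => i; rewrite leqnn !eqxx.
Qed.

Lemma sum_pair_sym : \sum_p F p =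
  \sum_i F (i, i) + \sum_(p : 'I_n * 'I_n | (p.1 < p.2)%N) (F p + F (p.2, p.1)).
Proof.
rewrite (bigID (fun p : 'I_n * 'I_n => p.1 <= p.2)%N) /= sum_pair_le -addrA.
congr (_ + _); rewrite big_split /=; congr (_ + _).
rewrite (reindex_onto (fun p => (p.2, p.1)) (fun p => (p.2, p.1))) => [|[i j]] //=.
by apply: eq_bigl => -[i j] /=; rewrite -ltnNge eqxx andbT.
Qed.

End TriangularSums.

Section Expand.
Variables (M N W : zmodType) (beta : M -> N -> W).
Variables (I K : finType) (b : I -> M) (c : I -> {additive M -> int}).
Variables (d : K -> N) (e : K -> {additive N -> int}).

Lemma biadditive_expand u v : biadditive beta ->
  u = dual_sum predT b c u -> v = dual_sum predT d e v ->
  beta u v = \sum_p beta (b p.1) (d p.2) *~ (c p.1 u * e p.2 v).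
Proof.
move=> bi {1}-> {1}->; rewrite /dual_sum (biadd_suml bi)
  -(pair_bigA _ (fun i j => beta (b i) (d j) *~ (c i u * e j v))) /=.
apply: eq_bigr => i _; rewrite (biadd_sumr bi) mulrz_suml; apply: eq_bigr => j _.
by rewrite mulrC mulrzA.
Qed.

Lemma biadditive_coef i k : biadditive (fun m n => c i m * e k n).
Proof. by split=> [v x y|u x y]; rewrite raddfB ?mulrBl ?mulrBr. Qed.

End Expand.

(** * Bases of the squares of a lattice *)

Section SquareCoefficients.
Variables (M W : zmodType) (n : nat) (b : 'I_n -> M).
Variable c : 'I_n -> {additive M -> int}.

(** The coefficient of b_i b_j in u v; on the diagonal the two terms would count
    the same product twice. *)
Definition sym_coef (p : 'I_n * 'I_n) (u v : M) : int :=
  c p.1 u * c p.2 v + (if p.1 == p.2 then 0 else c p.2 u * c p.1 v).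

Lemma sym_coef_biadditive p : biadditive (sym_coef p).
Proof.
rewrite /sym_coef; split=> [v x y|u x y]; case: eqP => _;
  by rewrite !raddfB ?(mulrBl, mulrBr) ?addr0 // opprD addrACA.
Qed.

Lemma sym_coefC p u v : sym_coef p u v = sym_coef p v u.
Proof.
rewrite /sym_coef; case: eqP => [->|_]; first by rewrite mulrC.
by rewrite addrC; congr (_ + _); rewrite mulrC.
Qed.

Definition alt_coef (p : 'I_n * 'I_n) (u v : M) : int :=
  c p.1 u * c p.2 v - c p.2 u * c p.1 v.

Lemma alt_coef_biadditive p : biadditive (alt_coef p).
Proof.
rewrite /alt_coef; split=> [v x y|u x y];
  by rewrite !raddfB ?(mulrBl, mulrBr) !opprD addrACA.
Qed.

Lemma alt_coefid p u : alt_coef p u u = 0.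
Proof. by rewrite /alt_coef mulrC subrr. Qed.

Variables (beta : M -> M -> W) (u v : M).
Hypotheses (bi : biadditive beta) (u_b : u = dual_sum predT b c u)
  (v_b : v = dual_sum predT b c v).

Lemma symmetric_expand : (forall x y, beta x y = beta y x) ->
  beta u v = \sum_(p : 'I_n * 'I_n | (p.1 <= p.2)%N)
               beta (b p.1) (b p.2) *~ sym_coef p u v.
Proof.
move=> betaC; rewrite (biadditive_expand bi u_b v_b) sum_pair_sym sum_pair_le.
congr (_ + _).
  by apply: eq_bigr => i _; rewrite /sym_coef eqxx addr0.
apply: eq_bigr => p lt_p; rewrite /sym_coef.
have /negPf -> : p.1 != p.2 by rewrite -val_eqE neq_ltn lt_p.
by rewrite mulrzDr [beta (b p.2) _]betaC [c p.2 u * _]mulrC.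
Qed.

Lemma alternating_expand : (forall x, beta x x = 0) ->
  beta u v = \sum_(p : 'I_n * 'I_n | (p.1 < p.2)%N)
               beta (b p.1) (b p.2) *~ alt_coef p u v.
Proof.
move=> beta0; have betaN x y : beta y x = - beta x y.
  apply/eqP; rewrite -addr_eq0; apply/eqP; rewrite -(beta0 (x + y)).
  rewrite (zmod_additive (bi.1 _)) !(zmod_additive (bi.2 _)).
  by rewrite !beta0 add0r addr0 addrC.
rewrite (biadditive_expand bi u_b v_b) sum_pair_sym.
rewrite big1 ?add0r => [|i _]; last by rewrite beta0 mul0rz.
by apply: eq_bigr => p _ /=; rewrite [beta (b p.2) _]betaN mulNrz -mulrzBr.
Qed.

End SquareCoefficients.

Section Squares.
Variables (gT : finGroupType) (M : gmodule gT) (n : nat).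
Variables (b : 'I_n -> M) (c : 'I_n -> {additive M -> int}).
Hypothesis bc : dual_basis predT b c.

Lemma tensor_dual_basis m (N : gmodule gT) (d : 'I_m -> N) e :
  dual_basis predT d e ->
  dual_basis predT (fun p : 'I_n * 'I_m => tens (b p.1) (d p.2))
    (fun p => tensor_lift (biadditive_coef c e p.1 p.2)).
Proof.
move=> de; split=> [w|[i k] [j l] _ _] /=; last first.
  by rewrite tensor_liftE bc.2 // de.2 // -natrM mulnb.
apply: (@tensor_ext _ _ _ _ idfun (dual_sum _ _ _)) => u v.
rewrite /= /dual_sum; under eq_bigr do rewrite tensor_liftE.
exact: biadditive_expand (tens_biadditive M N) (bc.1 u) (de.1 v).
Qed.

Lemma sym2_dual_basis :
  dual_basis (fun p : 'I_n * 'I_n => (p.1 <= p.2)%N)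
    (fun p => smul (b p.1) (b p.2))
    (fun p => sym2_lift (sym_coef_biadditive c p) (sym_coefC c p)).
Proof.
split=> [w|[i k] [j l] /= ik jl] /=; last first.
  rewrite sym2_liftE /sym_coef /= !bc.2 // -!natrM !mulnb -pair_eqE /=.
  case: (eqVneq i k) => [->|nik] /=; first by rewrite addr0.
  have -> : (k == j) && (i == l) = false; last by rewrite addr0.
  apply/negP => /andP[/eqP ekj /eqP eil]; case/eqP: nik; apply: val_inj.
  by apply/eqP; rewrite eqn_leq ik ekj eil.
apply: (@sym2_ext _ _ _ idfun (dual_sum _ _ _)) => u v /=.
rewrite [LHS](symmetric_expand (smul_biadditive M) (bc.1 u) (bc.1 v) (@smulC _ M)).
by apply: eq_bigr => p _; rewrite sym2_liftE.
Qed.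

Lemma ext2_dual_basis :
  dual_basis (fun p : 'I_n * 'I_n => (p.1 < p.2)%N)
    (fun p => wedge (b p.1) (b p.2))
    (fun p => ext2_lift (alt_coef_biadditive c p) (alt_coefid c p)).
Proof.
split=> [w|[i k] [j l] /= ik jl] /=; last first.
  rewrite ext2_liftE /alt_coef /= !bc.2 // -!natrM !mulnb -pair_eqE /=.
  have -> : (k == j) && (i == l) = false; last by rewrite subr0.
  apply/negP => /andP[/eqP ekj /eqP eil].
  by move: jl; rewrite -ekj -eil ltnNge ltnW.
apply: (@ext2_ext _ _ _ idfun (dual_sum _ _ _)) => u v /=.
rewrite [LHS](alternating_expand (wedge_biadditive M) (bc.1 u) (bc.1 v)
                (@wedgeid _ M)).
by apply: eq_bigr => p _; rewrite ext2_liftE.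
Qed.

End Squares.

Section SquareLattices.
Variables (gT : finGroupType) (M : gmodule gT).

Lemma tensor_lattice (N : gmodule gT) :
  is_lattice M -> is_lattice N -> is_lattice (tensor M N).
Proof.
case=> [m [b /zbasis_dual_basis [c bc]]] [n [d /zbasis_dual_basis [e de]]].
exact: dual_basis_lattice (tensor_dual_basis bc de).
Qed.

Lemma sym2_lattice : is_lattice M -> is_lattice (Sym2 M).
Proof.
case=> n [b /zbasis_dual_basis [c bc]].
exact: dual_basis_lattice (sym2_dual_basis bc).
Qed.

Lemma ext2_lattice : is_lattice M -> is_lattice (Ext2 M).
Proof.
case=> n [b /zbasis_dual_basis [c bc]].
exact: dual_basis_lattice (ext2_dual_basis bc).
Qed.

(** The group permutes the monomials b_i b_j, since commutativity lets any image be
    put back in increasing order. *)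
Lemma sym2_permutation : is_permutation_lattice M -> is_permutation_lattice (Sym2 M).
Proof.
case=> n [b [/zbasis_dual_basis [c bc] bG]].
apply: dual_basis_permutation (sym2_dual_basis bc) _ => g p _.
have [i' ei] := bG g p.1; have [j' ej] := bG g p.2; rewrite smul_act ei ej.
case: (leqP i' j') => [le_ij|/ltnW le_ji]; first by exists (i', j').
by exists (j', i') => //=; rewrite smulC.
Qed.

Lemma lattice_torsion_free (v : M) : is_lattice M -> v *+ 2 = 0 -> v = 0.
Proof.
by case=> n [b /zbasis_dual_basis [c bc]]; apply: (dual_basis_torsion_free bc).
Qed.

End SquareLattices.

(** * First cohomology of a permutation lattice *)

Definition crossed_hom (gT : finGroupType) (H : {group gT}) (M : gmodule gT)
    (f : subg_of H -> M) : Prop :=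
  forall g h, f (g * h)%g = f g + gact (sgval g) (f h).

Lemma H1_eq0 (gT : finGroupType) (H : {group gT}) (M : gmodule gT) :
  (forall f : subg_of H -> M, crossed_hom f ->
     exists m, forall g, f g = gact (sgval g) m - m) ->
  forall x : H1 H M, x = 0.
Proof.
move=> cobound x; have [f <-] := zpi_surj x; apply: zpi_gen.
by apply: cobound => g h; apply: (asboolW (valP f)).
Qed.

Section PermutationCohomology.
Variables (gT : finGroupType) (H : {group gT}) (P : gmodule gT).

(** Averaging shows that f is N times trivial, N the order of H: the sum W of the
    values of f satisfies W = N f(g) + g W.  So on a permuted basis W/N and its
    translates by H have coordinates that differ by integers; rounding the
    coordinates of W/N down therefore changes none of these differences, and gives
    an integral primitive of f. *)
Lemma permutation_crossed_hom (f : subg_of H -> P) :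
  is_permutation_lattice P -> crossed_hom f ->
  exists m, forall g, f g = gact (sgval g) m - m.
Proof.
case=> n [b [/zbasis_dual_basis [c bc] bG]] cf.
pose N : int := #|{: subg_of H}|%:Z.
have N0 : N != 0 by rewrite /N -cardsT -lt0n cardG_gt0.
pose W := \sum_h f h.
have WE g : W = f g *~ N + gact (sgval g) W.
  rewrite {1}/W (reindex_inj (mulgI g)) /=.
  under eq_bigr do rewrite cf.
  by rewrite big_split /= sumr_const -pmulrn -raddf_sum.
pose m := \sum_i b i *~ (c i W %/ N)%Z.
exists (- m) => g; rewrite raddfN opprK addrC.
apply/eqP; rewrite eq_sym subr_eq eq_sym; apply/eqP.
have [s sE] : exists s, forall i, gact (sgval g) (b i) = b (s i).
  by exists (fun i => sval (cid (bG (sgval g) i))) => i; case: (cid _).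
have s_inj : injective s.
  move=> i j eq_s; apply: (dual_basis_inj bc) => //.
  rewrite -[b i](gactP P).1 -[b j](gactP P).1 -(mulVg (sgval g)).
  by rewrite !(gactP P).2 !sE eq_s.
have cs i v : c (s i) (gact (sgval g) v) = c i v.
  rewrite {1}(bc.1 v) /dual_sum !raddf_sum (bigD1 i) //= big1 => [|j ji].
    by rewrite !raddfMz /= sE bc.2 // eqxx addr0 -mulrzl mulr1 intz.
  by rewrite !raddfMz /= sE bc.2 // (inj_eq s_inj) eq_sym (negPf ji) mul0rz.
rewrite /m raddf_sum {1}(bc.1 (f g)) /dual_sum.
rewrite (reindex_inj s_inj) [in RHS](reindex_inj s_inj) -big_split /=.
apply: eq_bigr => i _; rewrite raddfMz /= sE -mulrzDr; congr (_ *~ _).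
by rewrite {2}(WE g) raddfD raddfMz /= cs -mulrzl intz mulrC divzMDl.
Qed.

End PermutationCohomology.

(** * The symmetric squares of a permutation lattice and of its augmentation kernel *)

Section PermutationBasis.
Variables (gT : finGroupType) (X : gset gT).

Definition perm_coef (x : X) (u : perm_lattice X) : int := u x.

Fact perm_coef_zmod x : zmod_morphism (perm_coef x).
Proof. by move=> u v; rewrite /perm_coef !ffunE. Qed.

HB.instance Definition _ x :=
  GRing.isZmodMorphism.Build _ _ (perm_coef x) (perm_coef_zmod x).

Lemma perm_dual_basis : dual_basis predT (@perm_basis gT X) perm_coef.
Proof.
split=> [u|x y _ _]; last by rewrite /= /perm_coef ffunE.
apply/ffunP => x; rewrite -[RHS]/(perm_coef x _) /dual_sum raddf_sum (bigD1 x) //=.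
rewrite big1 => [|y yx]; rewrite raddfMz /= {1}/perm_coef ffunE.
  by rewrite eqxx addr0 intz.
by rewrite eq_sym (negPf yx) mul0rz.
Qed.

Lemma perm_lattice_permutation : is_permutation_lattice (perm_lattice X).
Proof.
apply: dual_basis_permutation perm_dual_basis _ => g x _.
by exists (gset_act g x); rewrite ?perm_basis_act.
Qed.

Lemma perm_ext (W : zmodType) (f f' : {additive perm_lattice X -> W}) :
  (forall x, f (perm_basis x) = f' (perm_basis x)) -> f =1 f'.
Proof.
move=> eq_f u; rewrite (perm_dual_basis.1 u) /dual_sum !raddf_sum.
by apply: eq_bigr => x _; rewrite !raddfMz eq_f.
Qed.

End PermutationBasis.

Definition aug_incl (gT : finGroupType) (X : gset gT) (a : aug_lattice X) :
  perm_lattice X := aug_val a.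

HB.instance Definition _ (gT : finGroupType) (X : gset gT) :=
  GRing.isZmodMorphism.Build (aug_lattice X) (perm_lattice X) (@aug_incl gT X)
    (fun a b => erefl).

Lemma augmentation_incl (gT : finGroupType) (X : gset gT) (a : aug_lattice X) :
  augmentation (aug_incl a) = 0.
Proof. by apply/eqP; exact: (valP (a : aug_sort X)). Qed.

(** The differences x - x0 for x other than a fixed x0 form a basis, with the
    values at these x as coordinates. *)
Lemma aug_lattice_lattice (gT : finGroupType) (X : gset gT) :
  is_lattice (aug_lattice X).
Proof.
pose c x : {additive aug_lattice X -> int} := (perm_coef x \o @aug_incl gT X)%FUN.
case: (pickP X) => [x0 _|X0]; last first.
  apply: (@dual_basis_lattice _ _ X pred0 (fun _ => 0) c); split=> // a.
  by apply: val_inj; apply/ffunP => x; have := X0 x.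
have eP x : perm_basis x - perm_basis x0 \in @aug_ker gT X.
  by apply/eqP; rewrite raddfB /= !augmentation_basis subrr.
pose e x : aug_lattice X := MkAug (eP x).
apply: (@dual_basis_lattice _ _ X (fun x => x != x0) e c); split=> [a|x y x_x0 y_x0].
  apply: val_inj; rewrite -[LHS]/(aug_incl a) -[RHS]/(aug_incl _).
  have -> : aug_incl (dual_sum (fun x => x != x0) e c a) =
      \sum_x (perm_basis x - perm_basis x0) *~ perm_coef x (aug_incl a).
    rewrite raddf_sum [RHS](bigD1 x0) //= subrr mul0rz add0r.
    by apply: eq_bigr => x _; apply: (raddfMz (@aug_incl gT X)).
  under eq_bigr do rewrite mulrzBl.
  rewrite sumrB -mulrz_sumr.
  rewrite -[X in X - _]/(dual_sum predT (@perm_basis gT X) (@perm_coef gT X) _).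
  by rewrite -(perm_dual_basis X).1 [\sum_x _](augmentation_incl a) mulr0z subr0.
by rewrite /= /perm_coef !ffunE (negPf x_x0) subr0.
Qed.

Section SquaresOfPermutationLattice.
Variables (gT : finGroupType) (X : gset gT).
Notation U := (perm_lattice X).
Notation A := (aug_lattice X).
Notation eps := (@augmentation gT X).

(** An additive and equivariant substitute for squaring, with which it agrees
    modulo 2 ([half_sqr]). *)
Definition sqr_lin (u : U) : Sym2 U :=
  \sum_x smul (perm_basis x) (perm_basis x) *~ perm_coef x u.

Fact sqr_lin_zmod : zmod_morphism sqr_lin.
Proof.
move=> u v; rewrite /sqr_lin -sumrB; apply: eq_bigr => i _.
by rewrite raddfB mulrzBr.
Qed.

HB.instance Definition _ := GRing.isZmodMorphism.Build _ _ sqr_lin sqr_lin_zmod.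

Lemma sqr_lin_basis x : sqr_lin (perm_basis x) = smul (perm_basis x) (perm_basis x).
Proof.
rewrite /sqr_lin (bigD1 x) //= big1 => [|y yx]; rewrite (perm_dual_basis X).2 //.
  by rewrite eqxx mulr1z addr0.
by rewrite (negPf yx) mulr0z.
Qed.

Lemma sqr_lin_act g u : sqr_lin (gact g u) = gact g (sqr_lin u).
Proof.
apply: (@perm_ext _ _ _ (sqr_lin \o gact g) (gact g \o sqr_lin)) => x.
by rewrite /= perm_basis_act !sqr_lin_basis smul_act perm_basis_act.
Qed.

(** The polar form of u |-> eps(u) u; it vanishes on pairs from A, and the
    induced map on Sym2 U has no further kernel ([contract_kernel]). *)
Definition contract_pair (u v : U) : U := v *~ eps u + u *~ eps v.

Lemma contract_pair_biadditive : biadditive contract_pair.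
Proof.
by rewrite /contract_pair; split=> [v x y|u x y];
  rewrite raddfB mulrzBl mulrzBr opprD addrACA.
Qed.

Lemma contract_pairC u v : contract_pair u v = contract_pair v u.
Proof. exact: addrC. Qed.

Definition contract : {additive Sym2 U -> U} :=
  sym2_lift contract_pair_biadditive contract_pairC.

Lemma contractE u v : contract (smul u v) = v *~ eps u + u *~ eps v.
Proof. exact: sym2_liftE. Qed.

Lemma contract_act g w : contract (gact g w) = gact g (contract w).
Proof.
apply: (@sym2_ext _ _ _ (contract \o gact g) (gact g \o contract)) => u v /=.
by rewrite smul_act !contractE raddfD !raddfMz !augmentation_act.
Qed.

Lemma eps_biadditive : biadditive (fun u v : U => eps u * eps v).
Proof. by split=> [v x y|u x y]; rewrite raddfB ?mulrBl ?mulrBr. Qed.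

Definition eps2 : {additive Sym2 U -> int} :=
  sym2_lift eps_biadditive (fun u v => mulrC (eps u) (eps v)).

Lemma eps2E u v : eps2 (smul u v) = eps u * eps v.
Proof. exact: sym2_liftE. Qed.

Lemma contract_sqr_lin u : contract (sqr_lin u) = u *+ 2.
Proof.
apply: (@perm_ext _ _ _ (contract \o sqr_lin) (GRing.add_fun idfun idfun)) => x /=.
by rewrite sqr_lin_basis contractE augmentation_basis.
Qed.

Lemma eps2_sqr_lin u : eps2 (sqr_lin u) = eps u.
Proof.
apply: (@perm_ext _ _ _ (eps2 \o sqr_lin) eps) => x /=.
by rewrite sqr_lin_basis eps2E augmentation_basis.
Qed.

Lemma eps_contract w : eps (contract w) = eps2 w *+ 2.
Proof.
apply: (@sym2_ext _ _ _ (eps \o contract) (GRing.add_fun eps2 eps2)) => u v /=.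
by rewrite contractE eps2E raddfD !raddfMz !mulrzz [eps v * _]mulrC.
Qed.

(** Squaring is additive modulo 2, so the u for which u^2 - q u is even form a
    subgroup, and X lies in it. *)
Lemma half_sqr u : exists v : Sym2 U, v *+ 2 = smul u u - sqr_lin u.
Proof.
have bi := smul_biadditive U.
pose even (u : U) := exists v : Sym2 U, v *+ 2 = smul u u - sqr_lin u.
have evenD x y : even x -> even y -> even (x + y).
  case=> [vx Ex] [vy Ey]; exists (vx + vy + smul x y).
  rewrite !mulrnDl Ex Ey (zmod_additive (bi.1 _)) !(zmod_additive (bi.2 _)) raddfD.
  rewrite [smul y x]smulC mulr2n opprD.
  by rewrite (AC (2*2*2) ((1*5)*(6*3)*(2*4))).
have evenN x : even x -> even (- x).
  case=> v Ev; exists (v + sqr_lin x); rewrite mulrnDl Ev !raddfN opprK.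
  rewrite (zmod_opp (bi.1 _)) (zmod_opp (bi.2 _)) opprK.
  by rewrite mulr2n addrA subrK.
have even0 : even 0.
  by exists 0; rewrite mul0rn raddf0 subr0 (zmod0 (bi.1 _)).
have even_mulz x k : even x -> even (x *~ k).
  have evenMn n : even x -> even (x *+ n).
    by move=> ex; elim: n => [|n IHn]; [rewrite mulr0n | rewrite mulrS; apply: evenD].
  by case: k => n ex; [apply: evenMn | apply/evenN/evenMn].
rewrite -/(even u) ((perm_dual_basis X).1 u) /dual_sum; apply: big_ind => // x _.
by apply: even_mulz; exists 0; rewrite mul0rn sqr_lin_basis subrr.
Qed.

Definition aug_incl2 : {additive Sym2 A -> Sym2 U} := sym2_map (@aug_incl gT X).

Lemma aug_incl2_act g w : aug_incl2 (gact g w) = gact g (aug_incl2 w).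
Proof. exact: sym2_map_act. Qed.

Lemma contract_aug w : contract (aug_incl2 w) = 0.
Proof.
apply: (@sym2_ext _ _ _ (contract \o aug_incl2) \0) => a b /=.
by rewrite sym2_mapE contractE !augmentation_incl !mulr0z addr0.
Qed.

Lemma eps2_aug w : eps2 (aug_incl2 w) = 0.
Proof.
apply: (@sym2_ext _ _ _ (eps2 \o aug_incl2) \0) => a b /=.
by rewrite sym2_mapE eps2E !augmentation_incl mulr0.
Qed.

(** A point t of X splits eps additively.  For empty X, where A = U = 0, the
    choice t = 0 satisfies the same identities. *)
Lemma aug_complement : exists t : U, exists p : {additive U -> A},
  (forall u, u = aug_incl (p u) + t *~ eps u) /\ (forall a, p (aug_incl a) = a).
Proof.
have [t tE] : exists t : U, forall u, eps u = eps u * eps t.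
  case: (pickP X) => [x _|X0].
    by exists (perm_basis x) => u; rewrite augmentation_basis mulr1.
  by exists 0 => u; rewrite raddf0 mulr0 /augmentation big_pred0.
have pP u : u - t *~ eps u \in @aug_ker gT X.
  by apply/eqP; rewrite raddfB raddfMz mulrzz mulrC -tE subrr.
pose p0 u : A := MkAug (pP u).
have p0_zmod : zmod_morphism p0.
  move=> u v; apply: val_inj => /=; rewrite raddfB mulrzBr !opprD opprK.
  by rewrite addrACA.
pose p : {additive U -> A} := HB.pack p0 (GRing.isZmodMorphism.Build _ _ _ p0_zmod).
exists t, p; split=> [u|a] /=; first by rewrite subrK.
by apply: val_inj; rewrite /= augmentation_incl mulr0z subr0.
Qed.

(** The symmetric square of a projection of U onto A is a left inverse. *)
Lemma aug_incl2_inj : injective aug_incl2.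
Proof.
have [t [p [_ pK]]] := aug_complement.
apply: (can_inj (g := sym2_map p)) => w.
apply: (@sym2_ext _ _ _ (sym2_map p \o aug_incl2) idfun) => a b /=.
by rewrite !sym2_mapE !pK.
Qed.

Lemma contract_kernel w : contract w = 0 -> exists l, aug_incl2 l = w.
Proof.
have [t [p [pE _]]] := aug_complement; move=> w0.
have bi := smul_biadditive U.
(* Both sides are additive in w, and on a product u v the identity results from
   substituting u = p u + eps(u) t and v = p v + eps(v) t. *)
have id_w : w = aug_incl2 (sym2_map p w) + smul (contract w) t - smul t t *~ eps2 w.
  pose smult : {additive U -> Sym2 U} :=
    HB.pack (fun u => smul u t) (GRing.isZmodMorphism.Build _ _ _ (bi.1 t)).
  pose mulzt : {additive int -> Sym2 U} :=
    HB.pack (fun k => smul t t *~ k)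
      (GRing.isZmodMorphism.Build int (Sym2 U) _ (@mulrzBr _ (smul t t))).
  apply: (@sym2_ext _ _ _ idfun (GRing.sub_fun
    (GRing.add_fun (aug_incl2 \o sym2_map p) (smult \o contract)) (mulzt \o eps2))).
  move=> u v /=; rewrite !sym2_mapE contractE eps2E.
  rewrite -[smul (_ + _) t]/(smult (_ + _)) raddfD !raddfMz /=.
  set a := aug_incl (p u); set b := aug_incl (p v).
  have -> : smul u v = smul a v + smul v t *~ eps u.
    rewrite {1}(pE u) (zmod_additive (bi.1 _)) (biadd_mulzl bi).
    by rewrite [smul t v]smulC.
  have -> : smul a v = smul a b + smul a t *~ eps v.
    by rewrite {1}(pE v) (zmod_additive (bi.2 _)) (biadd_mulzr bi).
  have -> : smul a t = smul u t - smul t t *~ eps u.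
    by rewrite {1}(pE u) (zmod_additive (bi.1 _)) (biadd_mulzl bi) addrK.
  rewrite mulrzBl mulrzA -!addrA; congr (_ + _).
  by rewrite [LHS]addrA [LHS]addrC !mulNrz.
have e2w : eps2 w = 0.
  by have /eqP := eps_contract w; rewrite w0 raddf0 eq_sym mulrn_eq0 => /eqP.
exists (sym2_map p w).
by rewrite [RHS]id_w w0 e2w mulr0z subr0 (zmod0 (bi.1 _)) addr0.
Qed.

End SquaresOfPermutationLattice.

Arguments contract {gT X}.
Arguments eps2 {gT X}.
Arguments aug_incl2 {gT X}.

(** * Coflasqueness *)

Section Coflasque.
Variables (gT : finGroupType) (X : gset gT).
Notation U := (perm_lattice X).
Notation A := (aug_lattice X).
Notation eps := (@augmentation gT X).

(** With v = (u^2 - q u) / 2 one has contract v = (eps(u) - 1) u, so the element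
    q (k u) - v lifts u; it is fixed by the stabiliser of u because twice it is
    given by an equivariant formula in u. *)
Lemma invariant_lift u k : eps u = k *+ 2 -> exists2 w : Sym2 U,
  contract w = u & forall g, gact g u = u -> gact g w = w.
Proof.
move=> eu; have [v v2] := half_sqr u.
have latU := permutation_lattice_lattice (perm_lattice_permutation X).
exists (sqr_lin (u *~ k) - v).
  apply/eqP; rewrite -subr_eq0; apply/eqP; apply: (lattice_torsion_free latU).
  rewrite mulrnBl -raddfMn mulrnBl v2 !raddfB !raddfMn /=.
  rewrite !contract_sqr_lin contractE eu [k *+ 2]mulr2n mulrzDr -mulr2n.
  by rewrite -mulr2n opprK addrA [_ + (_ + _)]addrA subrr add0r mulr2n addrK subrr.
move=> g gu; rewrite raddfB /= -sqr_lin_act raddfMz /= gu; congr (_ - _).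
apply/eqP; rewrite -subr_eq0; apply/eqP.
apply: (lattice_torsion_free (sym2_lattice latU)).
by rewrite mulrnBl -raddfMn v2 raddfB /= smul_act -sqr_lin_act gu subrr.
Qed.

Lemma sym2_aug_coflasque : coflasque (Sym2 A).
Proof.
split=> [|H]; first exact: sym2_lattice (aug_lattice_lattice X).
apply: H1_eq0 => f cf.
have [w wE] : exists w, forall g, aug_incl2 (f g) = gact (sgval g) w - w.
  apply: permutation_crossed_hom => [|g h].
    exact: sym2_permutation (perm_lattice_permutation X).
  by rewrite cf raddfD aug_incl2_act.
have [w' dw' w'_inv] := invariant_lift (eps_contract w).
have [l lE] : exists l, aug_incl2 l = w - w'.
  by apply: contract_kernel; rewrite raddfB dw' subrr.
exists l => g; apply: aug_incl2_inj.
rewrite wE raddfB /= aug_incl2_act lE raddfB /= (w'_inv (sgval g)).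
  by rewrite opprB addrA subrK.
apply/eqP; rewrite -subr_eq0 -contract_act -raddfB -wE.
by rewrite contract_aug.
Qed.

End Coflasque.

(** * An explicit splitting *)

Lemma split_gisomorphic (gT : finGroupType) (L S P : gmodule gT)
    (i : {additive L -> S}) (p : {additive S -> P}) (s : {additive P -> S}) :
    (forall g l, i (gact g l) = gact g (i l)) ->
    (forall g x, s (gact g x) = gact g (s x)) ->
    injective i -> (forall l, p (i l) = 0) ->
    (forall w, p w = 0 -> exists l, i l = w) -> (forall x, p (s x) = x) ->
  gisomorphic (dsum L P) S.
Proof.
move=> iG sG i_inj pi0 ker_p psK.
pose f (u : dsum L P) : S := i u.1 + s u.2.
have f_inj : injective f.
  move=> [l x] [l' x'] /= eq_f.
  have eq_x : x = x'.
    by have := congr1 p eq_f; rewrite !raddfD /= !pi0 !add0r !psK.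
  by move: eq_f; rewrite /f /= eq_x => /addIr /i_inj ->.
have f_surj y : exists u, f u = y.
  have [l lE] : exists l, i l = y - s (p y) by apply: ker_p; rewrite raddfB psK subrr.
  by exists (l, p y); rewrite /f /= lE subrK.
exists f; split; first split=> [[l x] [l' x']|g [l x]]; rewrite /f /=.
- by rewrite !raddfB opprD addrACA.
- by rewrite iG sG raddfD.
exists (fun y => sval (cid (f_surj y))) => [u|y]; last by case: (cid _).
by apply: f_inj; case: (cid _).
Qed.

Section TrivialLattice.
Variable gT : finGroupType.

Fact trivial_actP : is_laction (fun (_ : gT) (k : int) => k).
Proof. by []. Qed.

Fact trivial_act_zmod (g : gT) : zmod_morphism (fun k : int => k).
Proof. by []. Qed.

Definition trivial_lattice : gmodule gT := GModule trivial_actP trivial_act_zmod.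

Lemma trivial_lattice_permutation : is_permutation_lattice trivial_lattice.
Proof.
apply: (@dual_basis_permutation _ trivial_lattice unit predT (fun _ => 1 : int)
          (fun _ => idfun)) => [|g i _]; last by exists i.
split=> [v|[] [] _ _] //.
by rewrite /dual_sum (bigD1 tt) //= big1 => [|[]] //; rewrite addr0 intz.
Qed.

End TrivialLattice.

Section StablyPermutation.
Variables (gT : finGroupType) (X : gset gT) (u0 : perm_lattice X) (r : int).
Notation U := (perm_lattice X).
Notation Z := (trivial_lattice gT).
Notation A := (aug_lattice X).
Notation eps := (@augmentation gT X).
Hypotheses (u0G : forall g, gact g u0 = u0) (eps_u0 : eps u0 = r *+ 2 + 1).

Definition split_incl (l : Sym2 A) : dsum (Sym2 U) Z := (aug_incl2 l, 0 : int).

(** If eps(u0) = 2 r + 1, the projection is a composite of two steps.  The map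
    (w, n) |-> (contract w, n) goes onto U' + Z, where U' is the subgroup of U on
    which eps is even.  Both U' + Z and U + Z are isomorphic to the group of pairs
    (u, n) in U + Z with eps(u) = n modulo 2: the former by
    (u, n) |-> (u + n u0, n), the latter by (u, k) |-> (u, eps(u) + 2 k).  The
    second coordinate is thus (n - eps (contract w + n u0)) / 2. *)
Definition split_proj (w : dsum (Sym2 U) Z) : dsum U Z :=
  (contract w.1 + u0 *~ (w.2 : int), - eps2 w.1 - (w.2 : int) * r).

(** The basis element (x, 0) corresponds to (x - u0, 1) in U' + Z, and x - u0 is the
    contraction of (r + 1) x^2 - x u0; similarly (0, 1) corresponds to (-2 u0, 2),
    and -2 u0 is the contraction of - q u0.  These lifts are equivariant. *)
Definition split_section (u : dsum U Z) : dsum (Sym2 U) Z :=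
  (sqr_lin u.1 *~ (r + 1) - smul u.1 u0 - sqr_lin u0 *~ (u.2 : int),
   eps u.1 + (u.2 : int) *+ 2).

Fact split_incl_zmod : zmod_morphism split_incl.
Proof. by apply: dsum_pair_zmod => x y; [apply: raddfB | rewrite subr0]. Qed.

Fact split_proj_zmod : zmod_morphism split_proj.
Proof.
apply: dsum_pair_zmod => x y.
  by rewrite -[(x - y).1]/(x.1 - y.1) -[(x - y).2]/(x.2 - y.2) raddfB mulrzBr
    opprD addrACA.
rewrite -[(x - y).1]/(x.1 - y.1) -[(x - y).2]/((x.2 : int) - (y.2 : int)).
by rewrite raddfB mulrBl !opprD addrACA.
Qed.

Fact split_section_zmod : zmod_morphism split_section.
Proof.
apply: dsum_pair_zmod => x y.
  rewrite -[(x - y).1]/(x.1 - y.1) -[(x - y).2]/(x.2 - y.2).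
  rewrite raddfB mulrzBr mulrzBl ((smul_biadditive U).1 u0).
  have subACA (a b c d : Sym2 U) : a - b - (c - d) = a - c - (b - d).
    by rewrite !opprD addrACA.
  by rewrite [RHS]subACA; congr (_ - _); apply: subACA.
rewrite -[(x - y).1]/(x.1 - y.1) -[(x - y).2]/((x.2 : int) - (y.2 : int)).
by rewrite raddfB mulrnBl [in RHS]opprD [RHS]addrACA.
Qed.

HB.instance Definition _ := GRing.isZmodMorphism.Build _ _ split_incl split_incl_zmod.
HB.instance Definition _ := GRing.isZmodMorphism.Build _ _ split_proj split_proj_zmod.
HB.instance Definition _ :=
  GRing.isZmodMorphism.Build _ _ split_section split_section_zmod.

Lemma split_sectionK u : split_proj (split_section u) = u.
Proof.
case: u => u k; rewrite /split_proj /split_section /=; congr pair.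
  apply/ffunP => x; rewrite -[LHS]/(perm_coef x _) -[RHS]/(perm_coef x _).
  rewrite !(raddfB, raddfMz) /= !contract_sqr_lin contractE eps_u0.
  rewrite !(raddfD, raddfB, raddfMz, raddfMn) /= !mulrzz; ring.
rewrite !(raddfB, raddfMz) /= !eps2_sqr_lin eps2E eps_u0 !mulrzz; ring.
Qed.

Lemma split_proj_kernel w : split_proj w = 0 -> exists l, split_incl l = w.
Proof.
case: w => w k []; rewrite /= => dw ew.
have k0 : k = 0 :> int.
  have := eps_contract w.
  have -> : contract w = - (u0 *~ k) by apply/eqP; rewrite -addr_eq0 dw.
  (* The equations say eps2 w = - k r and - k (2 r + 1) = 2 eps2 w. *)
  rewrite raddfN raddfMz /= eps_u0 mulrzz => e2; lra.
move: dw; rewrite k0 mulr0z addr0 => /contract_kernel [l <-].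
by exists l.
Qed.

Lemma sym2_aug_stably_permutation : stably_permutation (Sym2 A).
Proof.
split; first exact: sym2_lattice (aug_lattice_lattice X).
have permU := perm_lattice_permutation X.
have permZ := trivial_lattice_permutation gT.
exists (dsum U Z), (dsum (Sym2 U) Z); split.
- exact: dsum_permutation.
- exact: dsum_permutation (sym2_permutation permU) permZ.
apply: (split_gisomorphic (i := split_incl) (p := split_proj) (s := split_section)).
- by move=> g l; rewrite /= /split_incl aug_incl2_act.
- move=> g [u k]; rewrite !dsum_actE; congr pair.
    by rewrite !raddfB !raddfMz /= smul_act u0G -!sqr_lin_act u0G.
  by rewrite augmentation_act.
- by move=> l l' [/aug_incl2_inj].
- move=> l; rewrite /= /split_proj /= contract_aug eps2_aug.
  by congr pair; rewrite ?mulr0z ?addr0 // mul0r subr0 oppr0.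
- exact: split_proj_kernel.
- exact: split_sectionK.
Qed.

End StablyPermutation.

(** * Exterior and tensor squares *)

Section AlternatingTensors.
Variables (gT : finGroupType) (M : gmodule gT).
Notation T := (tensor M M).

Definition alt_pair (m m' : M) : T := tens m m' - tens m' m.

Lemma alt_pair_biadditive : biadditive alt_pair.
Proof.
rewrite /alt_pair; split=> [v x y|u x y].
  by rewrite ((tens_biadditive M M).1 v) ((tens_biadditive M M).2 v)
     opprD [in RHS]opprD addrACA.
by rewrite ((tens_biadditive M M).1 u) ((tens_biadditive M M).2 u)
   opprD [in RHS]opprD addrACA.
Qed.

Definition alternate : {additive Ext2 M -> T} :=
  ext2_lift alt_pair_biadditive (fun m => subrr (tens m m)).

Lemma alternateE m m' : alternate (wedge m m') = tens m m' - tens m' m.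
Proof. exact: ext2_liftE. Qed.

Lemma alternate_act g w : alternate (gact g w) = gact g (alternate w).
Proof.
apply: (@ext2_ext _ _ _ (alternate \o gact g) (gact g \o alternate)) => m m' /=.
by rewrite wedge_act !alternateE raddfB /= !tens_act.
Qed.

(** Forgetting the lower triangle, m (x) m' |-> sum over i < j of
    c_i(m) c_j(m') b_i /\ b_j, is a left inverse. *)
Lemma alternate_inj : is_lattice M -> injective alternate.
Proof.
case=> n [b /zbasis_dual_basis [c bc]].
pose beta m m' : Ext2 M := \sum_(p : 'I_n * 'I_n | (p.1 < p.2)%N)
  wedge (b p.1) (b p.2) *~ (c p.1 m * c p.2 m').
have beta_bi : biadditive beta.
  split=> [v x y|u x y]; rewrite -sumrB; apply: eq_bigr => p _;
    by rewrite raddfB ?mulrBl ?mulrBr mulrzBr.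
apply: (can_inj (g := tensor_lift beta_bi)) => w.
apply: (@ext2_ext _ _ _ (tensor_lift beta_bi \o alternate) idfun) => u v /=.
rewrite alternateE raddfB !tensor_liftE /=.
rewrite [RHS](alternating_expand (wedge_biadditive M) (bc.1 u) (bc.1 v)
                (@wedgeid _ M)).
rewrite -sumrB; apply: eq_bigr => p _.
by rewrite -mulrzBr [c p.1 v * _]mulrC.
Qed.

Lemma to_sym2_alternate w : to_sym2 (alternate w) = 0.
Proof.
apply: (@ext2_ext _ _ _ (@to_sym2 _ M \o alternate) \0) => m m' /=.
by rewrite alternateE raddfB /= -!/(smul _ _) smulC subrr.
Qed.

Lemma alternate_image t : to_sym2 t = 0 -> exists w, alternate w = t.
Proof.
move=> t0; apply/asboolP.
apply: (@to_sym2_kernel _ _ (fun t => `[< exists w, alternate w = t >])) t0.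
  split=> [|_ _ /asboolP [w <-] /asboolP [w' <-]]; apply/asboolP.
    by exists 0; rewrite raddf0.
  by exists (w - w'); rewrite raddfB.
by move=> m m'; apply/asboolP; exists (wedge m m'); rewrite alternateE.
Qed.

End AlternatingTensors.

Arguments alternate {gT M}.

(** Adding P to M (x) M does not disturb the inclusion of Ext2 M, and replaces the
    quotient Sym2 M by the permutation lattice Sym2 M + P = Q. *)
Lemma ext2_equiv_tensor (gT : finGroupType) (M : gmodule gT) :
  is_lattice M -> stably_permutation (Sym2 M) ->
  lattice_equiv (Ext2 M) (tensor M M).
Proof.
move=> latM [_ [P [Q [permP permQ [h [[h_zmod hG] h_bij]]]]]].
pose h' : {additive dsum (Sym2 M) P -> Q} :=
  HB.pack h (GRing.isZmodMorphism.Build _ _ h h_zmod).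
have latT := tensor_lattice latM latM.
split=> //; first exact: ext2_lattice.
exists (dsum (tensor M M) P), Q, P; split=> //.
- exact: dsum_lattice latT (permutation_lattice_lattice permP).
- exists (fun w => (alternate w, 0)), (fun u => h (to_sym2 u.1, u.2)); split.
  + split=> [|g w]; first by apply: dsum_pair_zmod => x y; rewrite ?raddfB ?subrr.
    by rewrite alternate_act dsum_actE raddf0.
  + split=> [x y|g u]; first by rewrite -h_zmod; congr h; congr pair; apply: raddfB.
    by rewrite -hG !dsum_actE to_sym2_act.
  + by move=> w w' [/(alternate_inj latM)].
  + move=> [t x] /=; split=> [h0|[w [<- <-]]]; last first.
      by rewrite to_sym2_alternate; apply: (raddf0 h').
    have [/alternate_image [w <-] ->] : (to_sym2 t, x) = 0.
      by apply: (bij_inj h_bij); rewrite h0 [RHS](raddf0 h').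
    by exists w.
  + move=> y; have [k hk kh] := h_bij; case E: (k y) => [s x].
    have [t ts] := to_sym2_surj s.
    by exists (t, x); rewrite /= ts -E kh.
- exists (fun t => (t, 0)), (fun u => u.2); split.
  + split=> [|g w]; first by apply: dsum_pair_zmod => x y; rewrite ?subrr.
    by rewrite dsum_actE raddf0.
  + by split.
  + by move=> t t' [].
  + by move=> [t x] /=; split=> [->|[w []]//]; exists t.
  + by move=> x; exists (0, x).
Qed.

Lemma orbit_sum_odd (gT : finGroupType) (X : gset gT) (x : X) :
  odd #|gorbit x| -> exists u0 : perm_lattice X, exists r : int,
    (forall g, gact g u0 = u0) /\ augmentation u0 = r *+ 2 + 1.
Proof.
move=> odd_x; exists [ffun y => (y \in gorbit x)%:R], (#|gorbit x|./2)%:R.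
split=> [g|].
  apply/ffunP => y; rewrite !ffunE; congr (nat_of_bool _)%:R.
  have memg h z : z \in gorbit x -> gset_act h z \in gorbit x.
    by case/imsetP => k _ ->; rewrite -(gset_actP X).2; apply: imset_f.
  apply/idP/idP => [/(memg g)|]; last exact: memg.
  by rewrite -(gset_actP X).2 mulgV (gset_actP X).1.
rewrite /augmentation; under eq_bigr do rewrite ffunE.
rewrite -natr_sum -big_mkcond /= sum1_card -{1}(odd_double_half #|_|) odd_x.
by rewrite natrD addrC -muln2 natrM mulr_natr.
Qed.

Theorem proposition3p4 (gT : finGroupType) (X : gset gT) :
  coflasque (Sym2 (aug_lattice X)) /\
  ((exists x : X, odd #|gorbit x|) ->
    stably_permutation (Sym2 (aug_lattice X)) /\
    lattice_equiv (Ext2 (aug_lattice X))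
                  (tensor (aug_lattice X) (aug_lattice X))).
Proof.
split=> [|[x /orbit_sum_odd [u0 [r [u0G eps_u0]]]]].
  exact: sym2_aug_coflasque.
have stab := sym2_aug_stably_permutation u0G eps_u0.
by split=> //; apply: ext2_equiv_tensor (aug_lattice_lattice X) stab.
Qed.
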